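(* Let $f=(P,Q):\mathbb{C}^2\to\mathbb{C}^2$ be a polynomial map, with $P,Q\in\mathbb{C}[x,y]$ non-constant, $\deg_y P=\deg P$, $\deg_y Q=\deg Q$, and $J(P,Q)\not\equiv 0$. Let $\psi\in\Pi$ with $a_\psi>0$, $b_\psi>0$, and write $(a_\psi,b_\psi)=(Md,Me)$ with $M,d,e$ positive integers and $\gcd(d,e)=1$. Let $\varphi\in\Pi$ be a dicritical series of $f$ such that $\psi\prec\varphi$. If $\psi$ is not a singular series of $f$, then: (i) $(\deg p_\psi,\deg q_\psi)=(Nd,Ne)$ for some $N\in\mathbb{N}$; (ii) $a_\varphi=b_\varphi=0$, and there exist $C\in\mathbb{C}\setminus\{0\}$ and $D\in\mathbb{N}$ such that $$p_\varphi(\xi)=\mathrm{Lcoeff}(p_\psi)\,C^d\,\xi^{Dd}+\cdots,\qquad q_\varphi(\xi)=\mathrm{Lcoeff}(q_\psi)\,C^e\,\xi^{De}+\cdots,$$ where the dots denote terms of lower degree in $\xi$.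
   Context: $\mathbb{N}$ denotes the positive integers. $J(P,Q)=P_xQ_y-P_yQ_x$ is the Jacobian determinant. $\mathrm{Lcoeff}(h)$ is the coefficient of the leading (highest degree) term of a nonzero $h(\xi)\in\mathbb{C}[\xi]$. $\Pi$ is the set of all finite fractional power series of the form $$\varphi(x,\xi)=\sum_{k=1}^{n_\varphi-1}a_kx^{1-\frac{k}{m_\varphi}}+\xi x^{1-\frac{n_\varphi}{m_\varphi}},\qquad n_\varphi,m_\varphi\in\mathbb{N},\ a_k\in\mathbb{C},$$ where $\xi$ is a parameter and the common denominator $m_\varphi$ is taken minimal, i.e. $\gcd(\{m_\varphi,n_\varphi\}\cup\{k:a_k\neq0\})=1$. For $\psi,\varphi\in\Pi$, write $\psi\prec\varphi$ if $\varphi(x,\xi)=\psi(x,c+\text{lower terms in }x)$ for some $c\in\mathbb{C}$; here ''lower terms in $x$'' means a finite sum of terms with strictly negative fractional exponents of $x$ (with coefficients possibly depending on $\xi$). For $\varphi\in\Pi$ write, with lower terms having smaller exponents of $x$ and coefficients in $\mathbb{C}[\xi]$, $$P(x,\varphi(x,\xi))=p_\varphi(\xi)x^{a_\varphi/m_\varphi}+\text{lower terms in }x,\quad 0\ne p_\varphi\in\mathbb{C}[\xi],$$ $$Q(x,\varphi(x,\xi))=q_\varphi(\xi)x^{b_\varphi/m_\varphi}+\text{lower terms in }x,\quad 0\ne q_\varphi\in\mathbb{C}[\xi],$$ $$J(P,Q)(x,\varphi(x,\xi))=j_\varphi(\xi)x^{J_\varphi/m_\varphi}+\text{lower terms in }x,\quad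 0\ne j_\varphi\in\mathbb{C}[\xi].$$ The numbers $a_\varphi,b_\varphi,J_\varphi$ are integers. $\varphi$ is a horizontal series of $P$ if $a_\varphi=0$ and $\deg p_\varphi>0$; it is a horizontal series of $Q$ if $b_\varphi=0$ and $\deg q_\varphi>0$. $\varphi$ is a dicritical series of $f$ if it is a horizontal series of $P$ or of $Q$ and $\max\{a_\varphi,b_\varphi\}=0$. $\varphi$ is a singular series of $f$ if $\deg j_\varphi>0$. *)

(* Defs.v *)
From HB Require Import structures.
From mathcomp Require Import all_boot all_order all_algebra.
From mathcomp Require Import finmap monalg.
From mathcomp Require Import reals complex.

Set Implicit Arguments.
Unset Strict Implicit.
Unset Printing Implicit Defensive.

Import Order.TTheory GRing.Theory Num.Theory.

Local Open Scope fset_scope.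
Local Open Scope ring_scope.

(* Finite sums  \sum_r a_r x^r  with rational (possibly negative) exponents r  *)
(* and coefficients in A, i.e. the group algebra of (rat, +) over A. As an     *)
(* additive group this is {malg A[rat]}; monalg only provides the product for  *)
(* monoids without nontrivial units, so the product is defined here.           *)
Definition fracpoly (A : comNzRingType) : Type := {malg A[rat]}.

HB.instance Definition _ (A : comNzRingType) := GRing.Zmodule.on (fracpoly A).

(* The monomial a x^r. *)
Definition fpmono (A : comNzRingType) (r : rat) (a : A) : fracpoly A :=
  << a *g r >>.

Section FracPolyRing.
Variable A : comNzRingType.
Implicit Types (f g h : fracpoly A) (r s : rat).

Definition fpone : fracpoly A := fpmono 0 1.

Definition fpmul f g : fracpoly A :=
  \sum_(r <- msupp f) \sum_(s <- msupp g) fpmono (r + s) (f@_r * g@_s).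

Lemma fpmulw (d1 d2 : {fset rat}) f g :
  msupp f `<=` d1 -> msupp g `<=` d2 ->
  fpmul f g = \sum_(r <- d1) \sum_(s <- d2) fpmono (r + s) (f@_r * g@_s).
Proof.
move=> le_d1 le_d2; rewrite /fpmul /fpmono (big_fset_incl _ le_d1) /=.
  apply/eq_bigr=> k1 _; apply/big_fset_incl => // k _ /mcoeff_outdom ->.
  by rewrite mulr0 monalgU0.
move=> k _ /mcoeff_outdom g1k.
by rewrite big1 => // k' _; rewrite g1k mul0r monalgU0.
Qed.

Lemma fpmulC : commutative fpmul.
Proof.
move=> f g; rewrite /fpmul exchange_big; apply: eq_bigr => r _.
by apply: eq_bigr => s _; rewrite addrC mulrC.
Qed.

Lemma fpmul0 : left_zero 0 fpmul.
Proof. by move=> f; rewrite /fpmul msupp0 big_seq_fset0. Qed.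

Lemma fpmulDl : left_distributive fpmul +%R.
Proof.
move=> f g h; rewrite [in RHS](fpmulw (fsubsetUl _ (msupp g)) (fsubset_refl _)).
rewrite [in RHS](fpmulw (fsubsetUr (msupp f) _) (fsubset_refl _)).
rewrite (fpmulw (msuppD_le _ _) (fsubset_refl _)).
rewrite -big_split /=; apply/eq_bigr=> r _.
rewrite -big_split /=; apply/eq_bigr=> s _.
by rewrite /fpmono mcoeffD mulrDl monalgUD.
Qed.

Lemma fpmul_monol r (a : A) g :
  fpmul (fpmono r a) g = \sum_(s <- msupp g) fpmono (r + s) (a * g@_s).
Proof.
rewrite (fpmulw msuppU_le (fsubset_refl _)) big_seq_fset1.
by apply/eq_bigr => s _; rewrite mcoeffUU.
Qed.

Lemma fpmul_mono r s (a b : A) :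
  fpmul (fpmono r a) (fpmono s b) = fpmono (r + s) (a * b).
Proof. by rewrite (fpmulw msuppU_le msuppU_le) !big_seq_fset1 !mcoeffUU. Qed.

Lemma fpmonoE f : f = \sum_(r <- msupp f) fpmono r f@_r.
Proof. exact: monalgE. Qed.

Lemma fpmul1 : left_id fpone fpmul.
Proof.
move=> f; rewrite fpmul_monol [RHS]fpmonoE.
by apply: eq_bigr => s _; rewrite add0r mul1r.
Qed.

Lemma fpmul_suml (I : Type) (s : seq I) (F : I -> fracpoly A) g :
  fpmul (\sum_(i <- s) F i) g = \sum_(i <- s) fpmul (F i) g.
Proof. exact: (big_morph (fpmul^~ g) (fun a b => fpmulDl a b g) (fpmul0 g)). Qed.

Lemma fpmul_sumr (I : Type) (s : seq I) (F : I -> fracpoly A) g :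
  fpmul g (\sum_(i <- s) F i) = \sum_(i <- s) fpmul g (F i).
Proof. by rewrite fpmulC fpmul_suml; apply: eq_bigr => i _; rewrite fpmulC. Qed.

Lemma fpmulA : associative fpmul.
Proof.
move=> f g h; rewrite [f]fpmonoE !fpmul_suml; apply: eq_bigr => r _.
rewrite [g]fpmonoE !(fpmul_suml, fpmul_sumr); apply: eq_bigr => s _.
rewrite [h]fpmonoE !fpmul_sumr; apply: eq_bigr => t _.
by rewrite !fpmul_mono addrA mulrA.
Qed.

Lemma fpone_neq0 : fpone != 0.
Proof.
by apply/eqP/malgP=> /(_ 0) /eqP; rewrite mcoeffUU mcoeff0 oner_eq0.
Qed.

HB.instance Definition _ := GRing.Zmodule_isComNzRing.Build (fracpoly A)
  fpmulA fpmulC fpmul1 fpmulDl fpone_neq0.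

Lemma fpmulE f g :
  f * g = \sum_(r <- msupp f) \sum_(s <- msupp g) fpmono (r + s) (f@_r * g@_s).
Proof. by []. Qed.

End FracPolyRing.

(* The largest exponent of f and its coefficient; lead_expP below              *)
(* characterizes them for f != 0. For f = 0 both are 0.                        *)
Definition lead_exp (A : comNzRingType) (f : fracpoly A) : rat :=
  let s : seq rat := enum_fset (msupp f) in \big[Num.max/head 0 s]_(r <- s) r.

Definition lead_term (A : comNzRingType) (f : fracpoly A) : A :=
  f@_(lead_exp f).

Lemma lead_expP (A : comNzRingType) (f : fracpoly A) : f != 0 ->
  lead_term f != 0 /\ (forall r, lead_exp f < r -> f@_r = 0).
Proof.
move=> f0; rewrite /lead_term mcoeff_neq0 /lead_exp.
have memE r : (r \in msupp f) = (r \in enum_fset (msupp f)) by [].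
case E: (enum_fset (msupp f)) => [|a s] /=.
  case/eqP: f0; apply/malgP => r; rewrite mcoeff0.
  by apply/eqP; rewrite mcoeff_eq0 memE E.
split.
  rewrite memE E.
  rewrite big_seq; apply: (big_ind (fun r => r \in a :: s)) => //.
    exact: mem_head.
  by move=> r u rs us; rewrite maxEle; case: ifP.
move=> r; apply: contraTeq; rewrite mcoeff_neq0 memE E => rs.
have {}rs : r \in (a :: s : seq rat) by [].
by rewrite -leNgt; apply: (@le_bigmax_seq _ _ _ _ a r xpredT id rs isT).
Qed.

(* An element of Pi,                                                           *)
(*   phi(x, xi) = \sum_(1 <= k < n) a_k x^(1 - k/m) + xi x^(1 - n/m):          *)
(* fps_den phi is m, fps_coef phi is the list [:: a_1; ...; a_(n-1)] (so a_k   *)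
(* is its entry of index k.-1), and fps_num phi is n.                          *)
Record fps (F : comNzRingType) : Type := Fps {
  fps_den : nat;
  fps_coef : seq F;
  fps_den_gt0 : (0 < fps_den)%N;
  fps_den_min :
    gcdn (gcdn fps_den (size fps_coef).+1)
      (\big[gcdn/0%N]_(k < size fps_coef | fps_coef`_k != 0) k.+1) = 1%N
}.

Definition fps_num (F : comNzRingType) (phi : fps F) : nat :=
  (size (fps_coef phi)).+1.

(* phi(x, u), with u substituted for the parameter xi. Coefficients live in    *)
(* F[xi], represented by {poly F} with xi = 'X.                                *)
Definition fps_eval (F : comNzRingType) (phi : fps F)
    (u : fracpoly {poly F}) : fracpoly {poly F} :=
  let m : rat := (fps_den phi)%:R in
  \sum_(k < size (fps_coef phi))
      fpmono (1 - k.+1%:R / m) ((fps_coef phi)`_k)%:P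
  + u * fpmono (1 - (fps_num phi)%:R / m) 1.

Definition fpxi (F : comNzRingType) : fracpoly {poly F} := fpmono 0 'X.

Definition fpx (F : comNzRingType) : fracpoly {poly F} := fpmono 1 1.

(* psi < phi; L is the sum of lower terms, its coefficients may involve xi.    *)
Definition fps_prec (F : comNzRingType) (psi phi : fps F) : Prop :=
  exists (c : F) (L : fracpoly {poly F}),
    (forall r, r \in msupp L -> r < 0) /\
    fps_eval phi (fpxi F) = fps_eval psi (fpmono 0 c%:P + L).

(* F[x, y] is {poly {poly F}}: the outer variable is y, the inner one is x.    *)
Section Bivariate.
Variable F : comNzRingType.
Implicit Types P Q : {poly {poly F}}.

Definition degy P : nat := (size P).-1.

Definition total_deg P : nat :=
  (\max_(i < size P | (P`_i)%R != 0%R) (i + (size (P`_i)%R).-1))%N.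

Definition dx P : {poly {poly F}} := map_poly (@deriv F) P.
Definition dy P : {poly {poly F}} := P^`().

Definition jacobian P Q : {poly {poly F}} := dx P * dy Q - dy P * dx Q.

(* P(x, phi(x, xi)) *)
Definition subst_fps P (phi : fps F) : fracpoly {poly F} :=
  let evalx (c : {poly F}) :=
    (map_poly (fun a : F => fpmono 0 a%:P) c).[fpx F] in
  (map_poly evalx P).[fps_eval phi (fpxi F)].

(* P(x, phi(x, xi)) = lcoef_at P phi * x^(deg_at P phi / m_phi) + lower terms. *)
Definition deg_at P (phi : fps F) : rat :=
  lead_exp (subst_fps P phi) * (fps_den phi)%:R.

Definition lcoef_at P (phi : fps F) : {poly F} :=
  lead_term (subst_fps P phi).

Definition horizontal P (phi : fps F) : Prop :=
  deg_at P phi = 0 /\ (0 < (size (lcoef_at P phi)).-1)%N.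

Definition dicritical P Q (phi : fps F) : Prop :=
  (horizontal P phi \/ horizontal Q phi) /\
  Num.max (deg_at P phi) (deg_at Q phi) = 0.

Definition singular P Q (phi : fps F) : Prop :=
  (0 < (size (lcoef_at (jacobian P Q) phi)).-1)%N.

End Bivariate.

(* Main.v *)
(* Let psi(x, u0 + xi x^(-gap)) = phi(x, xi), where u0 does not involve xi,  *)
(* and put F = P(x, psi(x, u0 + xi)), G = Q(x, psi(x, u0 + xi)). In the      *)
(* Newton polygons of F and G (in x and xi), consider for t >= 0 the leading *)
(* forms with respect to the weight that gives x^r xi^k the value r - t k,   *)
(* that is, the leading coefficients p, q of F, G after xi is replaced by xi *)
(* x^(-t). As psi is not singular, the leading coefficient of J(P, Q) stays  *)
(* constant under all these substitutions, so, at exponents alpha d and      *)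
(* alpha e with alpha > 0, d p q' - e p' q is constant. It vanishes at xi =  *)
(* 0: as phi is dicritical, F and G have no monomial x^r with r > 0. Hence   *)
(* p^e and q^d are proportional. At t = 0 this gives (i), and it passes from *)
(* one vertex of the polygons to the next, so that both polygons are         *)
(* traversed simultaneously, with vertices in ratio d : e, until both        *)
(* weights vanish together. This happens at the slope t = gap, because phi   *)
(* is horizontal for P or for Q.                                             *)

From HB Require Import structures.
Require Import Defs.
From mathcomp Require Import all_boot all_order all_algebra.
From mathcomp Require Import reals complex.
From mathcomp Require Import finmap monalg.
From mathcomp Require Import ring lra zify.

Set Implicit Arguments.
Unset Strict Implicit.
Unset Printing Implicit Defensive.

Import Order.TTheory GRing.Theory Num.Theory.
Local Open Scope ring_scope.

(** The substitutions [xi_at psi phi t] join psi(x, u0 + xi), at t = 0, to phi, at t =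
    [gap psi phi]; raising t shears the Newton polygons of F and G. Three facts carry the argument.
    By the chain rule ([jacobian_subst_at]), the Wronskian of F and G in x and xi is a power of x
    times J(P, Q), and comparing leading coefficients gives d p q' = e p' q ([nonsingular_edge]).
    This equation says that p^e and q^d have the same logarithmic derivative; hence they are
    proportional, and both the degrees and the orders at 0 of p and q are in ratio d : e
    ([edge_proportional]). An edge therefore ends at a pair of vertices of the same shape as the
    pair where it began, with smaller xi-degrees, so an induction follows both polygons until the
    two weights reach 0 ([newton_walk]). Dicriticality identifies the final slope with
    [gap psi phi], so the last vertices are the top terms of p_phi and q_phi. The ratio of a^e to
    b^d is the same at all vertices (a, b) of the walk, and [coprime_power_pair] turns its
    preservation into the common constant C. *)

(** * Leading terms of fractional polynomials *)

Section FracPoly.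
Variable A : comNzRingType.
Implicit Types (f g : fracpoly A) (r s : rat) (a b : A).

Lemma fracpoly_ind (T : fracpoly A -> Prop) :
  (forall r a, T (fpmono r a)) ->
  (forall f g, T f -> T g -> T (f + g)) -> forall f, T f.
Proof.
move=> Tm TD f; rewrite [f]fpmonoE; elim/big_rec: _ => [|r g _ Tg].
  by have := Tm 0 0; rewrite /fpmono monalgU0.
exact: TD.
Qed.

Lemma fpmono_is_additive r : additive (@fpmono A r).
Proof. by move=> a b; rewrite /fpmono monalgUB. Qed.

HB.instance Definition _ r :=
  GRing.isAdditive.Build A (fracpoly A) (@fpmono A r) (fpmono_is_additive r).

Lemma fpmonoM r s a b : fpmono r a * fpmono s b = fpmono (r + s) (a * b).
Proof. exact: fpmul_mono. Qed.

Lemma fpmono1 : fpmono 0 1 = 1 :> fracpoly A.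
Proof. by []. Qed.

Lemma coef_fpmono r a s : (fpmono r a)@_s = if r == s then a else 0.
Proof. by rewrite mcoeffU; case: eqP. Qed.

Lemma fpX r a n : fpmono r a ^+ n = fpmono (r *+ n) (a ^+ n).
Proof. by elim: n => [|n IH]; rewrite ?exprS ?IH ?fpmonoM ?mulrS. Qed.

Lemma coef_fpmonoM r a f s : (fpmono r a * f)@_s = a * f@_(s - r).
Proof.
elim/fracpoly_ind: f => [u b|f g IHf IHg].
  rewrite fpmonoM !coef_fpmono -[u == _](inj_eq (addrI r)) addrCA subrr addr0.
  by case: ifP; rewrite ?mulr0.
by rewrite mulrDr !mcoeffD IHf IHg mulrDr.
Qed.

(** Only an upper bound on exponents: the coefficient at r itself may vanish. So the bound survives
    sums and products without case distinctions on cancellation. *)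
Definition fple (r : rat) f := forall s, r < s -> f@_s = 0.

Lemma fpleD r f g : fple r f -> fple r g -> fple r (f + g).
Proof. by move=> fr gr s rs; rewrite mcoeffD fr ?gr ?addr0. Qed.

Lemma fpleM r s f g : fple r f -> fple s g ->
  fple (r + s) (f * g) /\ (f * g)@_(r + s) = f@_r * g@_s.
Proof.
move=> fr gs.
have main t : (f * g)@_t = \sum_(u <- msupp f) f@_u * g@_(t - u).
  rewrite {1}[f]fpmonoE mulr_suml raddf_sum.
  by apply: eq_bigr => u _; rewrite /= coef_fpmonoM.
split=> [t rst|].
  rewrite main big1 // => u _.
  case: (ltP r u) => [/fr->|ur]; first by rewrite mul0r.
  by rewrite gs ?mulr0 //; lra.
rewrite main; have [rf|rf] := boolP (r \in msupp f).
  rewrite (big_fsetD1 r) //= addrAC subrr add0r big1_fset ?addr0 // => u.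
  rewrite !inE => /andP[ur _] _.
  case: (ltP r u) => [/fr->|ur']; first by rewrite mul0r.
  have {}ur : u < r by rewrite lt_neqAle ur.
  by rewrite gs ?mulr0 //; lra.
rewrite (mcoeff_outdom rf) mul0r big1_seq // => u /= uf.
case: (ltP r u) => [/fr->|ur]; first by rewrite mul0r.
have {}ur : u < r by rewrite lt_neqAle ur andbT; apply: contraNneq rf => <-.
by rewrite gs ?mulr0 //; lra.
Qed.

End FracPoly.

(** Chain rule for one variable over differentiated coefficients. It serves twice for a bivariate
    polynomial: for x over K, with [delta] zero, and for y over K[x], with z the derivative of x. *)
Lemma derivation_horner (A B : comNzRingType) (D : {additive B -> B})
    (delta : {additive A -> A}) (rho : {rmorphism A -> B}) (z y : B)
    (p : {poly A}) :
  (forall f g, D (f * g) = D f * g + f * D g) ->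
  (forall a, D (rho a) = rho (delta a) * z) ->
  D (map_poly rho p).[y] =
    (map_poly rho (map_poly delta p)).[y] * z + (map_poly rho p^`()).[y] * D y.
Proof.
move=> DM Drho; elim/poly_ind: p => [|p c IH].
  by rewrite !(map_poly0, deriv0, horner0, raddf0, mul0r, addr0).
have -> : map_poly delta (p * 'X + c%:P)
    = map_poly delta p * 'X + (delta c)%:P.
  rewrite raddfD /= map_polyC; congr (_ + _); apply/polyP=> i.
  by rewrite coef_map !coefMX coef_map; case: eqP; rewrite ?raddf0.
rewrite derivMXaddC !(rmorphD, rmorphM) /= !map_polyX !map_polyC /= !hornerE.
by rewrite raddfD /= DM IH Drho; ring.
Qed.

(** * Substitution for xi, derivations, and the chain rule for the Jacobian *)

Section Substitution.
Variable K : numFieldType.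
Local Notation fp := (fracpoly {poly K}).
Implicit Types (f g u : fp) (P Q : {poly {poly K}}).

Definition fpC (a : K) : fp := fpmono 0 a%:P.

Lemma fpC_is_additive : additive fpC.
Proof. by move=> a b; rewrite /fpC !raddfB. Qed.

Lemma fpC_is_multiplicative : multiplicative fpC.
Proof. by split=> [a b|]; rewrite /fpC ?fpmonoM ?addr0 ?polyCM. Qed.

HB.instance Definition _ := GRing.isAdditive.Build K fp fpC fpC_is_additive.
HB.instance Definition _ :=
  GRing.isMultiplicative.Build K fp fpC fpC_is_multiplicative.

(** One map for two variables: at [fpx K] it evaluates the x-coefficients of a bivariate polynomial,
    at other u it replaces xi. *)
Definition eval_coef u : {poly K} -> fp := horner_eval u \o map_poly fpC.
HB.instance Definition _ u := GRing.RMorphism.on (eval_coef u).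

Lemma eval_coefE u a : eval_coef u a = (map_poly fpC a).[u].
Proof. by []. Qed.

Lemma eval_coefC u c : eval_coef u c%:P = fpC c.
Proof. by rewrite eval_coefE map_polyC hornerC. Qed.

Definition subst_at P Y : fp := (map_poly (eval_coef (fpx K)) P).[Y].

Lemma subst_fpsE P (phi : fps K) :
  subst_fps P phi = subst_at P (fps_eval phi (fpxi K)).
Proof. by []. Qed.

Definition xi_subst u : fp -> fp :=
  mmap (eval_coef u) (fun r => fpmono r 1).
HB.instance Definition _ u := GRing.Additive.copy (xi_subst u)
  (mmap (eval_coef u) (fun r => fpmono r 1)).

Lemma xi_subst_mono u r a :
  xi_subst u (fpmono r a) = eval_coef u a * fpmono r 1.
Proof. exact: mmapU. Qed.

Lemma xi_subst_is_multiplicative u : multiplicative (xi_subst u).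
Proof.
split=> [f g|]; last by rewrite -fpmono1 xi_subst_mono rmorph1 mul1r.
elim/fracpoly_ind: f => [r a|f f' IH IH']; last first.
  by rewrite mulrDl !raddfD /= mulrDl IH IH'.
elim/fracpoly_ind: g => [s b|g g' IH IH']; last first.
  by rewrite mulrDr !raddfD /= mulrDr IH IH'.
by rewrite fpmonoM !xi_subst_mono rmorphM /= mulrACA fpmonoM mul1r.
Qed.

HB.instance Definition _ u := GRing.isMultiplicative.Build fp fp (xi_subst u)
  (xi_subst_is_multiplicative u).

Lemma xi_substC u a : xi_subst u (fpC a) = fpC a.
Proof. by rewrite xi_subst_mono eval_coefC mulr1. Qed.

Lemma xi_subst_x u r : xi_subst u (fpmono r 1) = fpmono r 1.
Proof. by rewrite xi_subst_mono rmorph1 mul1r. Qed.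

Lemma xi_subst_subst_at u P Y :
  xi_subst u (subst_at P Y) = subst_at P (xi_subst u Y).
Proof.
rewrite /subst_at -horner_map -map_poly_comp; congr (_.[_]).
apply: eq_map_poly => c /=.
rewrite !eval_coefE -horner_map -map_poly_comp /= xi_subst_x; congr (_.[_]).
by apply: eq_map_poly => a /=; rewrite xi_substC.
Qed.

Lemma xi_subst_fps_eval u (psi : fps K) v :
  xi_subst u (fps_eval psi v) = fps_eval psi (xi_subst u v).
Proof.
rewrite /fps_eval rmorphD rmorphM /= xi_subst_x rmorph_sum; congr (_ + _).
apply: eq_bigr => i _ /=.
by rewrite xi_subst_mono eval_coefC fpmonoM add0r mulr1.
Qed.

(** The substitution sends x^r xi^k to x^(r - t k) xi^k, so monomials are moved but never merged. *)
Lemma coef_xi_scale t f s k :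
  (xi_subst (fpmono (- t) 'X) f)@_s`_k = f@_(s + t * k%:R)`_k.
Proof.
elim/fracpoly_ind: f => [r a|f g IHf IHg]; last first.
  by rewrite (raddfD (xi_subst _)) /= !mcoeffD !coefD; congr (_ + _).
have -> : xi_subst (fpmono (- t) 'X) (fpmono r a) =
    \sum_(i < size a) fpmono (r - t * i%:R) (a`_i *: 'X^i).
  rewrite xi_subst_mono eval_coefE (horner_coef_wide _ (size_poly _ _)).
  rewrite mulr_suml; apply: eq_bigr => i _.
  rewrite coef_map /= fpX !fpmonoM !add0r mulr1 mul_polyC addrC.
  by rewrite mulNrn mulr_natr.
rewrite raddf_sum coef_sum coef_fpmono /=.
have E (i : 'I_(size a)) : (fpmono (r - t * i%:R) (a`_i *: 'X^i))@_s`_k =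
    if (r == s + t * k%:R) && (k == i) then a`_k else 0.
  rewrite coef_fpmono subr_eq; case: (k =P i) => [->|ki].
    by case: eqP; rewrite ?coef0 // coefZ coefXn eqxx mulr1.
  by rewrite andbF; case: eqP; rewrite ?coef0 // coefZ coefXn;
     case: eqP ki => // _ _; rewrite mulr0.
rewrite (eq_bigr _ (fun i _ => E i)); case: (r =P _) => /= [_|_]; last first.
  by rewrite big1 ?coef0.
case: (ltnP k (size a)) => [ka|ka].
  rewrite (bigD1 (Ordinal ka)) //= eqxx big1 ?addr0 // => i.
  by rewrite -val_eqE /= eq_sym => /negbTE ->.
by rewrite nth_default // big1 // => i _; case: eqP.
Qed.

(** Since u = v + lower terms, no exponent of x grows, and only the x^0 part of u reaches the
    coefficient at x^r. *)
Lemma xi_subst_lead u v f r : fple 0 u -> u@_0 = v -> fple r f ->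
  fple r (xi_subst u f) /\ (xi_subst u f)@_r = f@_r \Po v.
Proof.
move=> u0 uv.
have ev a : fple 0 (eval_coef u a) /\ (eval_coef u a)@_0 = a \Po v.
  elim/poly_ind: a => [|a c [IH IH']].
    by rewrite rmorph0 comp_poly0 mcoeff0; split=> // s _; rewrite mcoeff0.
  rewrite rmorphD rmorphM /= eval_coefC [eval_coef u 'X]eval_coefE.
  rewrite map_polyX hornerX comp_polyD comp_polyM comp_polyX comp_polyC.
  have [M M'] := fpleM IH u0; rewrite addr0 in M M'.
  rewrite mcoeffD M' IH' uv coef_fpmono eqxx; split=> //.
  apply: fpleD => // s s0; rewrite coef_fpmono; case: eqP => // s0'.
  by rewrite -s0' ltxx in s0.
have E s : (xi_subst u f)@_s =
    \sum_(t <- msupp f) (eval_coef u f@_t)@_(s - t).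
  rewrite {1}[f]fpmonoE [xi_subst u _]raddf_sum [LHS]raddf_sum.
  apply: eq_bigr => t _ /=.
  by rewrite xi_subst_mono mulrC coef_fpmonoM mul1r.
move=> fr; split=> [s rs|].
  rewrite E big1_seq // => t /= tf.
  case: (ltP r t) => [/fr ft|tr]; first by rewrite ft rmorph0 mcoeff0.
  by apply: (ev _).1; lra.
have zero t : t != r -> (eval_coef u f@_t)@_(r - t) = 0.
  move=> tr; case: (ltP r t) => [/fr ft|tr'].
    by rewrite ft rmorph0 mcoeff0.
  have {}tr : t < r by rewrite lt_neqAle tr.
  by apply: (ev _).1; lra.
have [rf|rf] := boolP (r \in msupp f).
  rewrite E (big_fsetD1 r) //= subrr (ev _).2 big1_fset ?addr0 // => t.
  by rewrite !inE => /andP[tr _] _; exact: zero.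
rewrite E (mcoeff_outdom rf) comp_poly0 big1_seq // => t /= tf.
by apply: zero; apply: contraNneq rf => <-.
Qed.

(* x d/dx rather than d/dx, so that exponents are preserved. *)
Definition theta : fp -> fp :=
  mmap (@fpmono {poly K} 0) (fun r => fpmono r (ratr r)%:P).
HB.instance Definition _ := GRing.Additive.copy theta
  (mmap (@fpmono {poly K} 0) (fun r => fpmono r (ratr r)%:P)).

Definition dxi : fp -> fp :=
  mmap (@fpmono {poly K} 0 \o @deriv K) (fun r => fpmono r 1).
HB.instance Definition _ := GRing.Additive.copy dxi
  (mmap (@fpmono {poly K} 0 \o @deriv K) (fun r => fpmono r 1)).

Lemma theta_mono r a : theta (fpmono r a) = fpmono r (a * (ratr r)%:P).
Proof. by rewrite /theta mmapU fpmonoM add0r. Qed.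

Lemma dxi_mono r a : dxi (fpmono r a) = fpmono r a^`().
Proof. by rewrite /dxi mmapU /= fpmonoM add0r mulr1. Qed.

Lemma coef_theta f r : (theta f)@_r = f@_r * (ratr r)%:P.
Proof.
elim/fracpoly_ind: f => [s a|f g IHf IHg].
  by rewrite theta_mono !coef_fpmono; case: eqP => [->|]; rewrite ?mul0r.
rewrite (raddfD theta) /= !mcoeffD mulrDl; congr (_ + _); exact.
Qed.

Lemma coef_dxi f r : (dxi f)@_r = (f@_r)^`().
Proof.
elim/fracpoly_ind: f => [s a|f g IHf IHg].
  by rewrite dxi_mono !coef_fpmono; case: eqP; rewrite ?deriv0.
rewrite (raddfD dxi) /= !mcoeffD derivD; congr (_ + _); exact.
Qed.

Lemma derivation_mono (D : {additive fp -> fp}) :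
  (forall r a s b, D (fpmono r a * fpmono s b) =
     D (fpmono r a) * fpmono s b + fpmono r a * D (fpmono s b)) ->
  forall f g, D (f * g) = D f * g + f * D g.
Proof.
move=> Dm f g; elim/fracpoly_ind: f => [r a|f f' IH IH']; last first.
  by rewrite mulrDl !raddfD /= IH IH'; ring.
elim/fracpoly_ind: g => [s b|g g' IH IH']; last first.
  by rewrite mulrDr !raddfD /= IH IH'; ring.
exact: Dm.
Qed.

Lemma thetaM f g : theta (f * g) = theta f * g + f * theta g.
Proof.
apply: derivation_mono => r a s b.
rewrite fpmonoM /= !theta_mono !fpmonoM -raddfD /=; congr fpmono.
by rewrite rmorphD polyCD; ring.
Qed.

Lemma dxiM f g : dxi (f * g) = dxi f * g + f * dxi g.
Proof.
apply: derivation_mono => r a s b.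
by rewrite fpmonoM /= !dxi_mono !fpmonoM -raddfD /= derivM.
Qed.

Lemma derivation_subst_at (D : {additive fp -> fp}) P Y :
  (forall f g, D (f * g) = D f * g + f * D g) -> (forall a, D (fpC a) = 0) ->
  D (subst_at P Y) =
    subst_at (dx P) Y * D (fpx K) + subst_at (dy P) Y * D Y.
Proof.
move=> DM DC; rewrite /subst_at /dx /dy.
apply: (@derivation_horner _ _ D (@deriv K) (eval_coef (fpx K))) => // c.
rewrite /= !eval_coefE.
have := @derivation_horner _ _ D (\0 : K -> K) fpC 0 (fpx K) c DM.
move=> ->; last by move=> a; rewrite DC mulr0.
by rewrite mulr0 add0r.
Qed.

(** The map (x, xi) to (x, Y) has Jacobian determinant [dxi Y]; the extra factor x comes from using
    x d/dx. *)
Lemma jacobian_subst_at P Q Y :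
  theta (subst_at P Y) * dxi (subst_at Q Y)
    - dxi (subst_at P Y) * theta (subst_at Q Y)
  = subst_at (jacobian P Q) Y * fpx K * dxi Y.
Proof.
have th R : theta (subst_at R Y) = subst_at (dx R) Y * fpx K
    + subst_at (dy R) Y * theta Y.
  rewrite (derivation_subst_at _ _ thetaM) /=.
    by rewrite theta_mono mul1r rmorph1.
  by move=> a; rewrite theta_mono rmorph0 mulr0 raddf0.
have dd R : dxi (subst_at R Y) = subst_at (dy R) Y * dxi Y.
  rewrite (derivation_subst_at _ _ dxiM) /=.
    by rewrite dxi_mono derivC raddf0 mulr0 add0r.
  by move=> a; rewrite dxi_mono derivC raddf0.
rewrite !th !dd /jacobian.
have -> : subst_at (dx P * dy Q - dy P * dx Q) Y =
    subst_at (dx P) Y * subst_at (dy Q) Y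
      - subst_at (dy P) Y * subst_at (dx Q) Y.
  by rewrite /subst_at rmorphB !rmorphM /= hornerD hornerN !hornerM.
move: (subst_at (dx P) Y) (subst_at (dy P) Y) (subst_at (dx Q) Y).
move: (subst_at (dy Q) Y) (theta Y) (dxi Y) (fpx K) => a b c x f g h.
by ring.
Qed.

End Substitution.

(** * The differential equation d p q' = e p' q *)

Section LogDerivative.
Variable K : numFieldType.
Implicit Types p q V W : {poly K}.

(** Common core of the two extreme cases, the top and the lowest coefficient of a product. *)
Lemma coefM_corner p q n m :
  (forall i j, (i + j = n + m)%N -> i != n -> p`_i * q`_j = 0) ->
  (p * q)`_(n + m) = p`_n * q`_m.
Proof.
move=> pq0; rewrite coefM.
have nm : (n < (n + m).+1)%N by rewrite ltnS leq_addr.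
rewrite (bigD1 (Ordinal nm)) //= addKn big1 ?addr0 // => i ni.
by apply: pq0; rewrite ?subnKC // -ltnS.
Qed.

Lemma coefM_top p q n m : (size p <= n.+1)%N -> (size q <= m.+1)%N ->
  (p * q)`_(n + m) = p`_n * q`_m.
Proof.
move=> sp sq; apply: coefM_corner => i j ij ni.
have [lt_ni|le_in] := ltnP n i.
  by rewrite [p`_i]nth_default ?mul0r // (leq_trans sp).
have lt_mj : (m < j)%N.
  have : (i < n)%N by rewrite ltn_neqAle ni.
  by move: ij => /eqP; lia.
by rewrite [q`_j]nth_default ?mulr0 // (leq_trans sq).
Qed.

Lemma coefM_bottom p q n m :
  (forall k, (k < n)%N -> p`_k = 0) -> (forall k, (k < m)%N -> q`_k = 0) ->
  (p * q)`_(n + m) = p`_n * q`_m.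
Proof.
move=> p0 q0; apply: coefM_corner => i j ij ni.
have [lt_in|le_ni] := ltnP i n; first by rewrite p0 ?mul0r.
rewrite q0 ?mulr0 //; have : (n < i)%N by rewrite ltn_neqAle eq_sym ni.
lia.
Qed.

Lemma coefX_bottom p n m : (forall k, (k < n)%N -> p`_k = 0) ->
  (forall k, (k < n * m)%N -> (p ^+ m)`_k = 0) /\
  (p ^+ m)`_(n * m) = p`_n ^+ m.
Proof.
move=> p0; elim: m => [|m [IH IH']].
  by rewrite muln0 !expr0 coef1.
rewrite mulnS exprS; split; last by rewrite coefM_bottom // IH' -exprS.
move=> k kn; rewrite coefM big1 // => i _.
have [lt_in|le_ni] := ltnP i n; first by rewrite p0 ?mul0r.
by rewrite IH ?mulr0 //; have := ltn_ord i; lia.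
Qed.

(** Multiplying the derivative by the variable removes the index shift, so that extreme coefficients
    can be compared directly. *)
Lemma coef_euler p k : ('X * p^`())`_k = p`_k *+ k.
Proof. by rewrite coefXM coef_deriv; case: k. Qed.

Lemma size_euler p : (size ('X * p^`())%R <= size p)%N.
Proof.
apply/leq_sizeP => k /leq_sizeP/(_ k (leqnn k)) pk.
by rewrite coef_euler pk mul0rn.
Qed.

(** After multiplication by the variable, the top coefficients of the two sides differ by the
    factors deg W and deg V, which must agree in characteristic 0. *)
Lemma log_deriv_size V W : V != 0 -> W != 0 -> W^`() * V = W * V^`() ->
  size W = size V.
Proof.
move=> V0 W0 eqVW.
have [n sW] : exists n, size W = n.+1.
  by exists (size W).-1; rewrite prednK // size_poly_gt0.
have [m sV] : exists m, size V = m.+1.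
  by exists (size V).-1; rewrite prednK // size_poly_gt0.
have eqX : ('X * W^`()) * V = W * ('X * V^`()).
  by rewrite -mulrA eqVW mulrCA.
have /eqP := congr1 (fun p : {poly K} => p`_(n + m)) eqX.
have eW := size_euler W; have eV := size_euler V.
rewrite !coefM_top -?sW -?sV // !coef_euler mulrnAl mulrnAr.
have WV0 : W`_n * V`_m != 0.
  have -> : W`_n = lead_coef W by rewrite lead_coefE sW.
  have -> : V`_m = lead_coef V by rewrite lead_coefE sV.
  by rewrite mulf_neq0 ?lead_coef_eq0.
by rewrite -subr_eq0 -[_ *+ n]mulr_natr -[_ *+ m]mulr_natr -mulrBr mulf_eq0
   (negPf WV0) subr_eq0 eqr_nat sW sV /= => /eqP ->.
Qed.

(** The combination U that cancels the top terms solves the same equation. If it were nonzero it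
    would have the size of V, contradicting the cancellation. *)
Lemma log_deriv_eq V W : V != 0 -> W != 0 -> W^`() * V = W * V^`() ->
  lead_coef V *: W = lead_coef W *: V.
Proof.
move=> V0 W0 eqVW; have sWV := log_deriv_size V0 W0 eqVW.
apply/eqP; rewrite -subr_eq0; apply/negPn/negP => U0.
set U := _ - _ in U0.
have eqU : U^`() * V = U * V^`().
  rewrite /U derivB !derivZ !mulrBl -!scalerAl eqVW.
  by rewrite [V^`() * V]mulrC.
have sU := log_deriv_size V0 U0 eqU.
have : U`_(size V).-1 = 0.
  by rewrite /U coefB !coefZ -sWV -lead_coefE sWV -lead_coefE mulrC subrr.
by move/eqP; rewrite -sU -lead_coefE lead_coef_eq0 (negPf U0).
Qed.

Lemma edge_proportional p q d e :
  (0 < d)%N -> (0 < e)%N -> coprime d e -> p != 0 -> q != 0 ->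
  p`_0 = 0 -> q`_0 = 0 ->
  d%:R *: (p * q^`()) = e%:R *: (p^`() * q) ->
  exists N s, [/\ size p = (N * d).+1, size q = (N * e).+1, (0 < s)%N,
    [/\ p`_(s * d) != 0, q`_(s * e) != 0,
    (forall k, (k < s * d)%N -> p`_k = 0) &
    (forall k, (k < s * e)%N -> q`_k = 0)] &
    p`_(s * d) ^+ e * lead_coef q ^+ d = lead_coef p ^+ e * q`_(s * e) ^+ d].
Proof.
move=> d0 e0 co p0 q0 p00 q00 eqpq.
have eqX : d%:R *: (p * ('X * q^`())) = e%:R *: (('X * p^`()) * q).
  by rewrite mulrCA -mulrA (scalerAr _ 'X) eqpq -scalerAr.
(* At extreme exponents n of p and m of q the equation reads d m = e n, and coprimality makes (n, m)
   a multiple of (d, e). This is used at the lowest exponents, giving s, and at the top ones, giving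
   N. *)
have corner n m :
    (p * ('X * q^`()))`_(n + m) = p`_n * ('X * q^`())`_m ->
    (('X * p^`()) * q)`_(n + m) = ('X * p^`())`_n * q`_m ->
    p`_n != 0 -> q`_m != 0 -> exists s, n = (s * d)%N /\ m = (s * e)%N.
  move=> c1 c2 pn qm.
  have := congr1 (fun r : {poly K} => r`_(n + m)) eqX.
  rewrite /= coefZ [in RHS]coefZ c1 c2 (coef_euler q) (coef_euler p).
  move: p`_n q`_m pn qm => a b a0 b0.
  rewrite -[b *+ m]mulr_natr -[a *+ n]mulr_natr => eqab.
  have dm : (d * m = e * n)%N.
    apply/eqP; rewrite -(eqr_nat K) !natrM -subr_eq0.
    have : a * b * (d%:R * m%:R - e%:R * n%:R) = 0 by ring: eqab.
    by move/eqP; rewrite !mulf_eq0 (negPf a0) (negPf b0).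
  have /dvdnP[s ns] : (d %| n)%N.
    by rewrite -(Gauss_dvdr _ co) -dm dvdn_mulr.
  exists s; split=> //; apply/eqP.
  by rewrite -(eqn_pmul2l d0) dm ns; apply/eqP; ring.
have low r : r != 0 :> {poly K} ->
    exists n, r`_n != 0 /\ forall k, (k < n)%N -> r`_k = 0.
  move=> r0; have ex : exists n, r`_n != 0.
    by exists (size r).-1; rewrite -lead_coefE lead_coef_eq0.
  exists (ex_minn ex); case: ex_minnP => n rn nmin; split=> // k kn.
  by apply/eqP; apply: contraTT kn => /nmin; rewrite -leqNgt.
have [n [pn pmin]] := low _ p0; have [m [qm qmin]] := low _ q0.
have [s [ns ms]] : exists s, n = (s * d)%N /\ m = (s * e)%N.
  apply: corner => //; apply: coefM_bottom => // k kn; rewrite coef_euler.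
    by rewrite qmin ?mul0rn.
  by rewrite pmin ?mul0rn.
have [N [nN mN]] : exists N, (size p).-1 = (N * d)%N /\ (size q).-1 = (N * e)%N.
  apply: corner; rewrite -?lead_coefE ?lead_coef_eq0 //.
    rewrite lead_coefE coefM_top // ?prednK ?size_poly_gt0 //.
    exact: size_euler.
  rewrite lead_coefE coefM_top // ?prednK ?size_poly_gt0 //.
  exact: size_euler.
subst n m; exists N, s; split=> //.
- by rewrite -nN prednK // size_poly_gt0.
- by rewrite -mN prednK // size_poly_gt0.
- by case: (s) pn; rewrite // mul0n p00 eqxx.
(* The equation in the form e p'/p = d q'/q. The final ratio compares the lowest coefficients of the
   proportional p^e and q^d. *)
have eqW : (p ^+ e)^`() * q ^+ d = p ^+ e * (q ^+ d)^`().
  have expS (r : {poly K}) n : (0 < n)%N -> r ^+ n = r * r ^+ n.-1.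
    by case: n => // n _; rewrite exprS.
  rewrite !deriv_exp (expS p e) // (expS q d) //.
  rewrite -[_ *+ e]mulr_natl -[_ *+ d]mulr_natl.
  have : e%:R * (p^`() * q) = d%:R * (p * q^`()).
    by rewrite !mulr_natl -!scaler_nat eqpq.
  move: (p ^+ e.-1) (q ^+ d.-1) p^`() q^`() => u v p' q' eq'.
  by ring: eq'.
have pe0 : p ^+ e != 0 by rewrite expf_neq0.
have qd0 : q ^+ d != 0 by rewrite expf_neq0.
have := congr1 (fun r : {poly K} => r`_(s * d * e)) (log_deriv_eq qd0 pe0 eqW).
rewrite !coefZ (coefX_bottom _ pmin).2.
have -> : (s * d * e = s * e * d)%N by ring.
by rewrite (coefX_bottom _ qmin).2 !lead_coef_exp mulrC.
Qed.

End LogDerivative.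

(** * Simultaneous descent along the two Newton polygons *)

Section NewtonWalk.
Variable K : numFieldType.
Local Notation fp := (fracpoly {poly K}).
Implicit Types (F G : fp) (r t : rat) (k : nat).

(** The line of constant weight r - t k through (r0, k0) bounds the Newton polygon. That (r0, k0) is
    itself a monomial of F is stated separately. *)
Definition dominates F t r0 k0 := forall r k, F@_r`_k != 0 ->
  r - t * k%:R <= r0 - t * k0%:R.

(** As t grows, monomials with k > k0 lose weight faster than the vertex, so only those with k < k0
    can catch up. The support being finite, there is a first slope at which one does, unless tau
    comes earlier. *)
Lemma next_break F t r0 k0 tau : t < tau -> dominates F t r0 k0 ->
  (forall r k, F@_r`_k != 0 -> (k < k0)%N -> r - t * k%:R < r0 - t * k0%:R) ->
  exists t1, [/\ t < t1, t1 <= tau, dominates F t1 r0 k0 &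
    t1 = tau \/
    exists2 k, (k < k0)%N & F@_(r0 - t1 * k0%:R + t1 * k%:R)`_k != 0].
Proof.
move=> ttau dom low.
pose S := [seq (r, k) | r <- enum_fset (msupp F), k <- iota 0 (size F@_r)].
have memS r k : F@_r`_k != 0 -> (r, k) \in S.
  move=> Frk; apply/allpairsPdep; exists r, k; split=> //.
    have : F@_r != 0 by apply: contraNneq Frk => ->; rewrite coef0.
    by rewrite mcoeff_neq0.
  rewrite mem_iota ltnNge; apply: contraNN Frk.
  by move=> /leq_sizeP/(_ k (leqnn k)) ->.
suff [t1 [tt1 t1tau domS brk]] : exists t1, [/\ t < t1, t1 <= tau,
    (forall r k, (r, k) \in S -> F@_r`_k != 0 ->
       r - t1 * k%:R <= r0 - t1 * k0%:R) &
    t1 = tau \/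
    exists2 k, (k < k0)%N & F@_(r0 - t1 * k0%:R + t1 * k%:R)`_k != 0].
  by exists t1; split=> // r k Frk; apply: domS => //; apply: memS.
elim: S {memS} => [|[r k] S [t1 [tt1 t1tau domS brk]]].
  by exists tau; split=> //; left.
have [F0|Frk] := eqVneq (F@_r`_k) 0.
  exists t1; split=> // r' k'; rewrite inE => /orP[/eqP[-> ->]|/domS//].
  by rewrite F0 eqxx.
have [rk|rk] := lerP (r - t1 * k%:R) (r0 - t1 * k0%:R).
  by exists t1; split=> // r' k'; rewrite inE => /orP[/eqP[-> ->]|/domS].
have d1 := dom _ _ Frk.
have kk0 : (k < k0)%N.
  rewrite ltnNge; apply/negP; rewrite -(ler_nat rat) => kk.
  have : (t1 - t) * (k%:R - k0%:R) >= 0 by apply: mulr_ge0; lra.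
  by lra.
have kk0' : 0 < k0%:R - k%:R :> rat by rewrite subr_gt0 ltr_nat.
(* The slope at which (r, k) ties with (r0, k0); the candidate t1 is lowered to it. *)
pose t2 := (r0 - r) / (k0%:R - k%:R).
have t2E : t2 * (k0%:R - k%:R) = r0 - r by rewrite /t2 divfK // gt_eqF.
have tt2 : t < t2.
  by rewrite ltr_pdivlMr //; have := low _ _ Frk kk0; lra.
have t2t1 : t2 < t1 by rewrite ltr_pdivrMr //; lra.
exists t2; split=> //.
- by apply: ltW; apply: lt_le_trans t1tau.
- move=> r' k'; rewrite inE => /orP[/eqP[-> ->] _|Sr F']; first by lra.
  have h1 := domS _ _ Sr F'; have h0 := dom _ _ F'.
  (* Weights are affine in the slope, so domination at t and at t1 gives it at t2 in between. *)
  have : (t1 - t) * (r0 - r' - t2 * (k0%:R - k'%:R)) >= 0.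
    have -> : (t1 - t) * (r0 - r' - t2 * (k0%:R - k'%:R)) =
      (t1 - t2) * (r0 - t * k0%:R - (r' - t * k'%:R)) +
      (t2 - t) * (r0 - t1 * k0%:R - (r' - t1 * k'%:R)) by ring.
    by rewrite addr_ge0 // mulr_ge0 //; lra.
  by rewrite pmulr_rge0; lra.
right; exists k => //.
suff -> : r0 - t2 * k0%:R + t2 * k%:R = r by [].
by lra.
Qed.

Lemma dominates_between F t t1 t2 r0 k0 : t <= t2 -> t2 <= t1 ->
  dominates F t r0 k0 -> dominates F t1 r0 k0 -> dominates F t2 r0 k0.
Proof.
move=> tt2 t2t1 d0 d1 r k Frk; have h0 := d0 _ _ Frk; have h1 := d1 _ _ Frk.
have [kk|kk] := lerP (k%:R : rat) k0%:R.
  have : (t1 - t2) * (k0%:R - k%:R) >= 0 by apply: mulr_ge0; lra.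
  by lra.
have : (t2 - t) * (k%:R - k0%:R) >= 0 by apply: mulr_ge0; lra.
by lra.
Qed.

Definition shear t : fp -> fp := xi_subst (fpmono (- t) 'X).

Lemma coef_shear t F s k : (shear t F)@_s`_k = F@_(s + t * k%:R)`_k.
Proof. exact: coef_xi_scale. Qed.

Lemma shearD t F G : shear t (F + G) = shear t F + shear t G.
Proof. exact: raddfD. Qed.

Lemma shear_xi t : shear t (fpxi K) = fpmono (- t) 'X.
Proof.
by rewrite /shear xi_subst_mono fpmono1 mulr1 eval_coefE map_polyX hornerX.
Qed.

Lemma shear_subst_fps t (P : {poly {poly K}}) (psi : fps K) v :
  shear t (subst_at P (fps_eval psi v)) =
    subst_at P (fps_eval psi (shear t v)).
Proof. by rewrite /shear xi_subst_subst_at xi_subst_fps_eval. Qed.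

(* Otherwise comparing [shear t F] with [shear t G] unfolds both of them. *)
Opaque shear.

Lemma dominates_shear F t r0 k0 : dominates F t r0 k0 ->
  fple (r0 - t * k0%:R) (shear t F).
Proof.
move=> dom s rs; apply/polyP => k; rewrite coef0 coef_shear.
by apply/eqP; apply: contraLR rs => /dom; rewrite addrK -leNgt.
Qed.

(** End state of the walk: sheared by tau, F has no positive exponent of x, and its coefficient at
    x^0 has degree at most n. *)
Definition zero_edge F tau n := forall r k, F@_r`_k != 0 ->
  r <= tau * k%:R /\ (r = tau * k%:R -> (k <= n)%N).

Lemma ratio_trans (x y u v A B : K) d e : y != 0 ->
  x ^+ e * B ^+ d = A ^+ e * y ^+ d -> u ^+ e * y ^+ d = x ^+ e * v ^+ d ->
  u ^+ e * B ^+ d = A ^+ e * v ^+ d.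
Proof.
move=> y0 xy uv; have yd : y ^+ d != 0 by rewrite expf_neq0.
by apply: (mulIf yd); rewrite mulrAC uv mulrAC xy mulrAC.
Qed.

Variables (F G : fp) (d e : nat) (A B : K).
Hypotheses (d_gt0 : (0 < d)%N) (e_gt0 : (0 < e)%N) (co_de : coprime d e).
Hypotheses (F_pure : forall r, 0 < r -> F@_r`_0 = 0)
  (G_pure : forall r, 0 < r -> G@_r`_0 = 0).
(** All that the walk knows about the Jacobian; [nonsingular_edge] supplies it. *)
Hypothesis edge_eq : forall t alpha, 0 <= t -> 0 < alpha ->
  fple (alpha * d%:R) (shear t F) -> fple (alpha * e%:R) (shear t G) ->
  (shear t F)@_(alpha * d%:R)`_0 = 0 -> (shear t G)@_(alpha * e%:R)`_0 = 0 ->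
  let p := (shear t F)@_(alpha * d%:R) in
  let q := (shear t G)@_(alpha * e%:R) in
  d%:R *: (p * q^`()) = e%:R *: (p^`() * q).

(** A shear fixes xi-free monomials, so purity of F and G makes p and q vanish at xi = 0. *)
Lemma edge_at t alpha : 0 <= t -> 0 < alpha ->
  let p := (shear t F)@_(alpha * d%:R) in
  let q := (shear t G)@_(alpha * e%:R) in
  fple (alpha * d%:R) (shear t F) -> fple (alpha * e%:R) (shear t G) ->
  p != 0 -> q != 0 ->
  exists N s, [/\ size p = (N * d).+1, size q = (N * e).+1, (0 < s)%N,
    [/\ p`_(s * d) != 0, q`_(s * e) != 0,
    (forall k, (k < s * d)%N -> p`_k = 0) &
    (forall k, (k < s * e)%N -> q`_k = 0)] &
    p`_(s * d) ^+ e * lead_coef q ^+ d = lead_coef p ^+ e * q`_(s * e) ^+ d].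
Proof.
move=> t0 al0 p q Fle Gle p0 q0.
have p00 : p`_0 = 0.
  by rewrite coef_shear mulr0 addr0 F_pure // mulr_gt0 // ltr0n.
have q00 : q`_0 = 0.
  by rewrite coef_shear mulr0 addr0 G_pure // mulr_gt0 // ltr0n.
exact: edge_proportional d_gt0 e_gt0 co_de p0 q0 p00 q00
  (edge_eq t0 al0 Fle Gle p00 q00).
Qed.

(** Strong induction on s. The current vertices are (rho d, s d) and (rho e, s e), each the lowest
    point in xi of its edge at slope t. Either both survive until their weights vanish, or at the
    first break [edge_at] gives new vertices of the same shape with s' < s. *)
Lemma newton_walk s t rho : (0 < s)%N -> 0 <= t -> t * s%:R < rho ->
  dominates F t (rho * d%:R) (s * d) -> dominates G t (rho * e%:R) (s * e) ->
  (forall r k, F@_r`_k != 0 -> (k < s * d)%N ->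
     r - t * k%:R < rho * d%:R - t * (s * d)%:R) ->
  (forall r k, G@_r`_k != 0 -> (k < s * e)%N ->
     r - t * k%:R < rho * e%:R - t * (s * e)%:R) ->
  F@_(rho * d%:R)`_(s * d) != 0 -> G@_(rho * e%:R)`_(s * e) != 0 ->
  F@_(rho * d%:R)`_(s * d) ^+ e * B ^+ d =
    A ^+ e * G@_(rho * e%:R)`_(s * e) ^+ d ->
  exists tau D, [/\ 0 < tau, (0 < D)%N,
    zero_edge F tau (D * d), zero_edge G tau (D * e) &
    let a := F@_(tau * (D * d)%:R)`_(D * d) in
    let b := G@_(tau * (D * e)%:R)`_(D * e) in
    [/\ a != 0, b != 0 & a ^+ e * B ^+ d = A ^+ e * b ^+ d]].
Proof.
have [n] := ubnP s.
elim: n s t rho => // n IH s t rho; rewrite ltnS => sn s0 t0 tsr.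
move=> domF domG lowF lowG Fv Gv ratio.
have s0' : 0 < s%:R :> rat by rewrite ltr0n.
have d0' : 0 < d%:R :> rat by rewrite ltr0n.
have e0' : 0 < e%:R :> rat by rewrite ltr0n.
(* Both vertices reach weight 0 at this same slope, as their coordinates are in ratio d : e. *)
pose tau := rho / s%:R.
have tauE : tau * s%:R = rho by rewrite /tau divfK // gt_eqF.
have ttau : t < tau by rewrite ltr_pdivlMr.
have [tF [ttF tFtau domF1 brkF]] := next_break ttau domF lowF.
have [tG [ttG tGtau domG1 brkG]] := next_break ttau domG lowG.
pose t1 := Num.min tF tG.
have tt1 : t < t1 by rewrite lt_min ttF.
have t1tau : t1 <= tau by rewrite ge_min tFtau.
have domF2 : dominates F t1 (rho * d%:R) (s * d).
  by apply: dominates_between domF domF1; rewrite ?ge_min ?lexx // ltW.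
have domG2 : dominates G t1 (rho * e%:R) (s * e).
  by apply: dominates_between domG domG1; rewrite ?ge_min ?lexx ?orbT // ltW.
have above H m r k : dominates H t (rho * m%:R) (s * m) -> H@_r`_k != 0 ->
    (s * m < k)%N -> r - t1 * k%:R < rho * m%:R - t1 * (s * m)%:R.
  move=> dom /dom h; rewrite -(ltr_nat rat) => sk.
  have : (t1 - t) * (k%:R - (s * m)%:R) > 0 by apply: mulr_gt0; lra.
  by lra.
have [t1eq|t1neq] := eqVneq t1 tau.
  have zero m : rho * m%:R - t1 * (s * m)%:R = 0.
    by rewrite t1eq natrM mulrA tauE subrr.
  exists tau, s; split=> //; first by apply: le_lt_trans ttau.
  - move=> r k Frk; have := domF2 _ _ Frk; rewrite zero t1eq subr_le0 => h.
    split=> // req; rewrite leqNgt; apply/negP => /(above _ _ _ _ domF Frk).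
    by rewrite zero t1eq req subrr ltxx.
  - move=> r k Grk; have := domG2 _ _ Grk; rewrite zero t1eq subr_le0 => h.
    split=> // req; rewrite leqNgt; apply/negP => /(above _ _ _ _ domG Grk).
    by rewrite zero t1eq req subrr ltxx.
  - by rewrite !natrM !mulrA tauE.
have {t1neq} t1tau' : t1 < tau by rewrite lt_neqAle t1neq.
(* The weights of the two vertices at the break are [al * d] and [al * e], still positive because t1
   < tau. *)
pose al := rho - t1 * s%:R.
have al0 : 0 < al by rewrite subr_gt0 -tauE ltr_pM2r.
have alE m : rho * m%:R - t1 * (s * m)%:R = al * m%:R.
  by rewrite /al natrM; ring.
have FleA := dominates_shear domF2; have GleA := dominates_shear domG2.
rewrite !alE in FleA GleA.
have t10 : 0 <= t1 by apply: ltW; apply: le_lt_trans tt1.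
(* The old vertex is the top term of the new edge polynomial: higher powers of xi have fallen
   strictly below. *)
have top H m : dominates H t (rho * m%:R) (s * m) ->
    H@_(rho * m%:R)`_(s * m) != 0 ->
    size (shear t1 H)@_(al * m%:R) = (s * m).+1 /\
    (shear t1 H)@_(al * m%:R)`_(s * m) = H@_(rho * m%:R)`_(s * m).
  move=> dom Hv.
  have c : (shear t1 H)@_(al * m%:R)`_(s * m) = H@_(rho * m%:R)`_(s * m).
    by rewrite coef_shear -alE subrK.
  split=> //; apply/eqP; rewrite eqn_leq; apply/andP; split.
    apply/leq_sizeP => k sk; rewrite coef_shear; apply/eqP/negPn/negP.
    by move=> /(above _ _ _ _ dom) /(_ sk); rewrite addrK alE ltxx.
  rewrite ltnNge; apply/negP => /leq_sizeP/(_ _ (leqnn _)) c0.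
  by rewrite -c c0 eqxx in Hv.
have [szF topF] := top _ _ domF Fv; have [szG topG] := top _ _ domG Gv.
have p0 : (shear t1 F)@_(al * d%:R) != 0 by rewrite -size_poly_eq0 szF.
have q0 : (shear t1 G)@_(al * e%:R) != 0 by rewrite -size_poly_eq0 szG.
have [N [s' [szF' szG' s'0 [pv qv plow qlow] rat']]] :=
  edge_at t10 al0 FleA GleA p0 q0.
(* The polygon that breaks first has a monomial with k < s m on the new edge, while nothing on that
   edge lies below s' m. Hence s' m <= k < s m. *)
have s's : (s' < s)%N.
  have contra (H : fp) m k : (0 < m)%N -> (k < s * m)%N ->
      H@_(rho * m%:R - t1 * (s * m)%:R + t1 * k%:R)`_k != 0 ->
      (forall j, (j < s' * m)%N -> (shear t1 H)@_(al * m%:R)`_j = 0) ->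
      (s' < s)%N.
    move=> m0 ks Hk low; rewrite -(ltn_pmul2r m0); apply: leq_ltn_trans ks.
    rewrite leqNgt; apply/negP => /low; rewrite coef_shear -alE => H0.
    by rewrite H0 eqxx in Hk.
  have [tFG|tGF] := leP tF tG.
    have t1F : t1 = tF by rewrite /t1 min_l.
    case: brkF => [tFeq|[k ks Fk]]; first by rewrite -tFeq t1F ltxx in t1tau'.
    by apply: (contra F d k) => //; rewrite t1F.
  have t1G : t1 = tG by rewrite /t1 min_r // ltW.
  case: brkG => [tGeq|[k ks Gk]]; first by rewrite -tGeq t1G ltxx in t1tau'.
  by apply: (contra G e k) => //; rewrite t1G.
have s'0' : 0 < s'%:R :> rat by rewrite ltr0n.
(* Chosen so that the new vertices (rho' m, s' m) have weight [al * m] at slope t1. *)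
pose rho' := al + t1 * s'%:R.
have vE m : rho' * m%:R = al * m%:R + t1 * (s' * m)%:R.
  by rewrite /rho' natrM; ring.
have wE m : rho' * m%:R - t1 * (s' * m)%:R = al * m%:R by rewrite vE addrK.
have cH (H : fp) m : (shear t1 H)@_(al * m%:R)`_(s' * m) =
    H@_(rho' * m%:R)`_(s' * m).
  by rewrite vE; apply: coef_shear.
apply: (IH s' t1 rho') => //.
- exact: leq_trans s's sn.
- by rewrite /rho'; lra.
- by move=> r k Frk; rewrite wE -alE; apply: domF2.
- by move=> r k Grk; rewrite wE -alE; apply: domG2.
- move=> r k Frk ks; rewrite wE lt_neqAle -alE domF2 // andbT alE.
  apply: contraNneq Frk => req; have := plow _ ks.
  by rewrite coef_shear -req subrK => ->.
- move=> r k Grk ks; rewrite wE lt_neqAle -alE domG2 // andbT alE.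
  apply: contraNneq Grk => req; have := qlow _ ks.
  by rewrite coef_shear -req subrK => ->.
- by rewrite -(cH F d); exact: pv.
- by rewrite -(cH G e); exact: qv.
rewrite -(cH F d) -(cH G e).
have lF : lead_coef (shear t1 F)@_(al * d%:R) = F@_(rho * d%:R)`_(s * d).
  by rewrite lead_coefE szF.
have lG : lead_coef (shear t1 G)@_(al * e%:R) = G@_(rho * e%:R)`_(s * e).
  by rewrite lead_coefE szG.
refine (ratio_trans Gv ratio _).
exact: etrans (congr1 (fun z => _ * z ^+ d) (esym lG))
  (etrans rat' (congr1 (fun z => z ^+ e * _) lF)).
Qed.

End NewtonWalk.

(** * From psi to phi: the edge equation and the final slope *)

Section Setting.
Variable K : numFieldType.
Local Notation fp := (fracpoly {poly K}).
Implicit Types (f F L : fp) (psi phi : fps K) (P Q : {poly {poly K}}).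

Lemma fple_lead_exp f : fple (lead_exp f) f.
Proof.
have [->|f0] := eqVneq f 0; first by move=> r _; rewrite mcoeff0.
by case: (lead_expP f0).
Qed.

Lemma lead_exp_unique f r : f@_r != 0 -> fple r f -> lead_exp f = r.
Proof.
move=> fr le_r; have f0 : f != 0.
  by apply: contraNneq fr => ->; rewrite mcoeff0.
have [lead0 above] := lead_expP f0; apply/eqP; rewrite eq_le.
apply/andP; split; rewrite leNgt; apply/negP.
  by move=> /le_r fr0; rewrite /lead_term fr0 eqxx in lead0.
by move=> /above fr0; rewrite fr0 eqxx in fr.
Qed.

Definition xi_free f := forall r k, (0 < k)%N -> f@_r`_k = 0.

Lemma dxi_xi_free f : xi_free f -> dxi f = 0.
Proof.
move=> ff; apply/malgP => r; rewrite coef_dxi mcoeff0; apply/polyP => k.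
by rewrite coef_deriv ff ?mul0rn ?coef0.
Qed.

Lemma shear_xi_free t f : xi_free f -> shear t f = f.
Proof.
move=> ff; apply/malgP => r; apply/polyP => k; rewrite coef_shear.
by case: k => [|k]; rewrite ?mulr0 ?addr0 // !ff.
Qed.

Definition fps_exp psi : rat := 1 - (fps_num psi)%:R / (fps_den psi)%:R.

Definition fps_head psi : fp := fps_eval psi 0.

Lemma fps_evalE psi v :
  fps_eval psi v = fps_head psi + v * fpmono (fps_exp psi) 1.
Proof. by rewrite /fps_head /fps_eval mul0r addr0. Qed.

Lemma fps_head_xi_free psi : xi_free (fps_head psi).
Proof.
move=> r k k0; rewrite /fps_head /fps_eval mul0r addr0 raddf_sum coef_sum.
rewrite big1 // => i _; rewrite /= coef_fpmono; case: eqP; rewrite ?coef0 //.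
by rewrite coefC; case: k k0.
Qed.

Definition gap psi phi := fps_exp psi - fps_exp phi.

(** The u0 for which psi(x, u0 + xi x^(-gap)) = phi(x, xi). *)
Definition shift psi phi : fp :=
  fpmono (- fps_exp psi) 1 * (fps_head phi - fps_head psi).

Lemma shift_xi_free psi phi : xi_free (shift psi phi).
Proof.
have xi_freeB f g : xi_free f -> xi_free g -> xi_free (f - g).
  by move=> ff gf r k k0; rewrite mcoeffB coefB ff // gf // subrr.
move=> r k k0; rewrite coef_fpmonoM mul1r; apply: xi_freeB k0.
  exact: fps_head_xi_free.
exact: fps_head_xi_free.
Qed.

Definition xi_at psi phi t : fp := shift psi phi + fpmono (- t) 'X.

Lemma xi_at_gap psi phi v : fps_eval phi (fpxi K) = fps_eval psi v ->
  xi_at psi phi (gap psi phi) = v.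
Proof.
rewrite !fps_evalE => E.
have {}E : fps_head phi - fps_head psi =
    v * fpmono (fps_exp psi) 1 - fpxi K * fpmono (fps_exp phi) 1.
  move: E; move: (fps_head phi) (fps_head psi).
  move: (v * _) (fpxi K * _) => x y a b E.
  by rewrite -(addrK y a) E addrAC [b + x]addrC addrK.
rewrite /xi_at /shift E mulrBr mulrCA fpmonoM /fpxi !fpmonoM addNr mul1r.
rewrite mulr1 fpmono1 mulr1 mul1r add0r.
have -> : - fps_exp psi + fps_exp phi = - gap psi phi.
  by rewrite /gap; ring.
by rewrite addrNK.
Qed.

Lemma shear_xi_at psi phi t : shear t (xi_at psi phi 0) = xi_at psi phi t.
Proof.
rewrite /xi_at shearD shear_xi_free; last exact: shift_xi_free.
by rewrite oppr0 shear_xi.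
Qed.

Lemma dxi_fps_eval psi phi t :
  dxi (fps_eval psi (xi_at psi phi t)) = fpmono (fps_exp psi - t) 1.
Proof.
rewrite fps_evalE (raddfD (@dxi K)) /= dxiM dxi_xi_free; last first.
  exact: fps_head_xi_free.
rewrite (raddfD (@dxi K)) /= dxi_xi_free; last exact: shift_xi_free.
rewrite !dxi_mono derivX derivC raddf0 mulr0 addr0 !add0r fpmonoM mulr1.
by rewrite addrC.
Qed.

Lemma fps_eval_xi_subst psi u :
  fps_eval psi u = xi_subst u (fps_eval psi (fpxi K)).
Proof.
rewrite xi_subst_fps_eval xi_subst_mono fpmono1 mulr1 eval_coefE map_polyX.
by rewrite hornerX.
Qed.

(** Here u0 + xi x^(-gap) = c + L. As u0 and c are free of xi, the term in xi must come from L, so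
    its exponent is negative; comparing exponents >= 0 then gives u0 = c + lower terms. *)
Lemma prec_shift psi phi c L : (forall r, r \in msupp L -> r < 0) ->
  fps_eval phi (fpxi K) = fps_eval psi (fpmono 0 c%:P + L) ->
  [/\ 0 < gap psi phi, fple 0 (shift psi phi) & (shift psi phi)@_0 = c%:P].
Proof.
move=> Lneg /xi_at_gap E.
have L0 r : 0 <= r -> L@_r = 0.
  by move=> r0; apply: mcoeff_outdom; apply: contraL r0 => /Lneg; rewrite ltNge.
have Er r : (shift psi phi)@_r + (if - gap psi phi == r then 'X else 0) =
    (if 0 == r then c%:P else 0) + L@_r.
  by rewrite -!coef_fpmono -!mcoeffD -E.
have gap0 : 0 < gap psi phi.
  rewrite ltNge; apply/negP => gle.
  have := congr1 (fun p : {poly K} => p`_1%N) (Er (- gap psi phi)).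
  rewrite eqxx !coefD shift_xi_free // coefX L0 ?oppr_ge0 // coef0 add0r addr0.
  by case: (0 == _); rewrite ?coefC ?coef0 => /eqP; rewrite oner_eq0.
have zero r : 0 <= r -> (- gap psi phi == r) = false.
  by move=> r0; apply: contraTF r0 => /eqP <-; rewrite oppr_ge0 -ltNge.
split=> // [r r0|].
  have := Er r; rewrite zero ?ltW // L0 ?ltW // !addr0 => ->.
  by case: eqP => // r0'; rewrite -r0' ltxx in r0.
by have := Er 0; rewrite zero // L0 // !addr0 ?eqxx.
Qed.

(** [theta] multiplies by the exponent, so at a = alpha d, b = alpha e the coefficient is alpha (d p
    q' - e p' q). *)
Lemma lead_exp_wronskian f g a b : fple a f -> fple b g ->
  fple (a + b) (theta f * dxi g - dxi f * theta g) /\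
  (theta f * dxi g - dxi f * theta g)@_(a + b) =
    (ratr a)%:P * (f@_a * (g@_b)^`()) - (ratr b)%:P * ((f@_a)^`() * g@_b).
Proof.
move=> fa gb.
have th (h : fp) r : fple r h -> fple r (theta h).
  by move=> hr s rs; rewrite coef_theta hr // mul0r.
have dd (h : fp) r : fple r h -> fple r (dxi h).
  by move=> hr s rs; rewrite coef_dxi hr // deriv0.
have [le1 c1] := fpleM (th _ _ fa) (dd _ _ gb).
have [le2 c2] := fpleM (dd _ _ fa) (th _ _ gb).
have coef_sub (x y : fp) r u v : x@_r = u -> y@_r = v -> (x - y)@_r = u - v.
  by move=> <- <-; exact: mcoeffB.
split.
  by move=> s rs; rewrite (coef_sub _ _ _ _ _ (le1 s rs) (le2 s rs)) subrr.
rewrite coef_theta coef_dxi in c1; rewrite coef_theta coef_dxi in c2.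
rewrite (coef_sub _ _ _ _ _ c1 c2).
move: (f@_a) (g@_b) => p q; move: p^`() q^`() => p' q'; ring.
Qed.

(** The Wronskian is x^sg times J(P, Q) along psi with xi replaced. Since the leading coefficient j
    of the latter is constant, the replacement changes neither it nor its exponent. *)
Lemma nonsingular_edge P Q psi phi t alpha d e c :
  ~ singular P Q psi -> 0 <= t -> 0 < alpha ->
  fple 0 (shift psi phi) -> (shift psi phi)@_0 = c%:P ->
  let f := subst_at P (fps_eval psi (xi_at psi phi t)) in
  let g := subst_at Q (fps_eval psi (xi_at psi phi t)) in
  let p := f@_(alpha * d%:R) in let q := g@_(alpha * e%:R) in
  fple (alpha * d%:R) f -> fple (alpha * e%:R) g -> p`_0 = 0 -> q`_0 = 0 ->
  d%:R *: (p * q^`()) = e%:R *: (p^`() * q).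
Proof.
move=> nonsing t0 al0 sh_le sh0 f g p q fle gle p0 q0.
have [Wle Wc] := lead_exp_wronskian fle gle.
set W := theta f * dxi g - dxi f * theta g in Wle Wc.
rewrite -/p -/q in Wc.
pose J0 := subst_fps (jacobian P Q) psi.
pose T := xi_subst (xi_at psi phi t) J0.
pose sg := 1 + (fps_exp psi - t).
have WE : W = fpmono sg 1 * T.
  rewrite /W jacobian_subst_at dxi_fps_eval -mulrA fpmonoM mulr1 mulrC.
  by rewrite /T /J0 subst_fpsE xi_subst_subst_at -fps_eval_xi_subst.
have Wcoef r : W@_r = T@_(r - sg) by rewrite WE coef_fpmonoM mul1r.
have [j jE] : exists j, J0@_(lead_exp J0) = j%:P.
  exists (J0@_(lead_exp J0))`_0; apply: size1_polyC; rewrite leqNgt.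
  apply/negP => sz; apply: nonsing.
  by rewrite /singular /lcoef_at /lead_term -subn1 subn_gt0.
have xi_le : fple 0 (xi_at psi phi t).
  apply: fpleD => // r r0; rewrite coef_fpmono; case: eqP => // req.
  by rewrite -req oppr_gt0 ltNge t0 in r0.
have [v vE] : exists v, (xi_at psi phi t)@_0 = v by eexists.
have [Tle Tc] := xi_subst_lead xi_le vE (@fple_lead_exp J0).
rewrite -/T jE comp_polyC in Tle Tc.
suff W0 : W@_(alpha * d%:R + alpha * e%:R) = 0.
  have al_neq0 : (ratr alpha : K) != 0 by rewrite fmorph_eq0 gt_eqF.
  apply: (scalerI al_neq0).
  move/eqP: Wc; rewrite W0 eq_sym subr_eq0 !mul_polyC !rmorphM /= !ratr_nat.
  by rewrite -!scalerA => /eqP.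
have j0 : j = 0 -> W@_(alpha * d%:R + alpha * e%:R) = 0.
  move=> j0; have J00 : J0 = 0.
    apply/eqP/negPn/negP => /lead_expP[] /negP + _; apply.
    by rewrite /lead_term jE j0.
  by rewrite Wcoef /T J00 raddf0 mcoeff0.
(* Below the leading exponent, the bound on W forces j = 0; above it, the coefficient is 0. At
   equality the coefficient is the constant j, and evaluation at xi = 0 gives j = 0. *)
have [lt_w|gt_w|eq_w] := ltgtP (alpha * d%:R + alpha * e%:R - sg) (lead_exp J0).
- apply: j0; apply/eqP; rewrite -polyC_eq0 -Tc.
  have := Wle (lead_exp J0 + sg); rewrite Wcoef addrK => -> //.
  by rewrite -ltrBlDr.
- by rewrite Wcoef Tle.
apply: j0; have := congr1 (fun r : {poly K} => r`_0) Wc.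
rewrite /= Wcoef eq_w Tc coefC eqxx => ->.
by rewrite coefB !coefCM !coef0M p0 q0 !(mul0r, mulr0) subrr.
Qed.

(** With the Bezout relation u d = v e + 1, take C = x^u / y^v. *)
Lemma coprime_power_pair (x y : K) d e : x != 0 -> y != 0 -> (0 < d)%N ->
  coprime d e -> x ^+ e = y ^+ d ->
  exists C, [/\ C != 0, x = C ^+ d & y = C ^+ e].
Proof.
move=> x0 y0 d0 /eqP co xy; have [u v uv _] := egcdnP e d0; rewrite co in uv.
exists (x ^+ u / y ^+ v); split.
- by rewrite mulf_neq0 ?invr_eq0 ?expf_neq0.
- rewrite expr_div_n -!exprM uv [(v * d)%N]mulnC [y ^+ _]exprM -xy -exprM.
  by rewrite mulnC addn1 exprS mulfK ?expf_neq0.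
rewrite expr_div_n -!exprM [(u * e)%N]mulnC exprM xy -exprM mulnC uv addn1.
by rewrite exprS mulfK ?expf_neq0.
Qed.

Lemma zero_edge_lead (F : fp) t n : zero_edge F t n -> F@_(t * n%:R)`_n != 0 ->
  [/\ fple 0 (shear t F), lead_exp (shear t F) = 0 &
    exists2 p : {poly K}, (size p <= n)%N &
      lead_term (shear t F) = F@_(t * n%:R)`_n *: 'X^n + p].
Proof.
move=> ze Fn; have le0 : fple 0 (shear t F).
  move=> s s0; apply/polyP => k; rewrite coef0 coef_shear; apply/eqP.
  by apply: contraLR s0 => /ze[]; rewrite -leNgt gerDr.
have cn : (shear t F)@_0`_n = F@_(t * n%:R)`_n by rewrite coef_shear add0r.
have E : lead_exp (shear t F) = 0.
  apply: lead_exp_unique => //; apply: contraNneq Fn => f0.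
  by rewrite -cn f0 coef0.
split=> //; exists ((shear t F)@_0 - F@_(t * n%:R)`_n *: 'X^n); last first.
  by rewrite /lead_term E addrC subrK.
apply/leq_sizeP => k; rewrite leq_eqVlt => /orP[/eqP<-|nk].
  by rewrite coefB coefZ coefXn eqxx mulr1 cn subrr.
rewrite coefB coefZ coefXn gtn_eqF // mulr0 subr0 coef_shear add0r.
by apply/eqP; apply: contraLR nk => /ze[_ /(_ erefl)]; rewrite -leqNgt.
Qed.

(** If g < t, the shear by g would leave x^(t n) xi^n at the positive exponent (t - g) n. *)
Lemma zero_edge_slope_le (F : fp) t g n : zero_edge F t n -> (0 < n)%N ->
  F@_(t * n%:R)`_n != 0 -> fple 0 (shear g F) -> t <= g.
Proof.
move=> ze n0 Fn le0; rewrite leNgt; apply/negP => gt.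
move/negP: Fn; apply; apply/eqP.
have -> : t * n%:R = (t - g) * n%:R + g * n%:R by ring.
by rewrite -coef_shear le0 ?coef0 // mulr_gt0 ?ltr0n // subr_gt0.
Qed.

(** A term xi^k with k > 0 at x^0 after the shear by g comes from x^(g k) xi^k, whence g k <= t
    k. *)
Lemma zero_edge_slope_ge (F : fp) t g n : zero_edge F t n ->
  (0 < (size (shear g F)@_(0%R : rat)).-1)%N -> g <= t.
Proof.
set p := (shear g F)@_0 => ze k0.
have pk : p`_(size p).-1 != 0.
  rewrite -lead_coefE lead_coef_eq0; apply: contraTneq k0 => ->.
  by rewrite size_poly0.
by move: pk; rewrite coef_shear add0r => /ze[]; rewrite ler_pM2r ?ltr0n.
Qed.

End Setting.

(** * Assembling the walk from psi to phi *)

Section Conclusion.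
Variable K : numFieldType.
Local Notation fp := (fracpoly {poly K}).
Implicit Types (F : fp) (psi phi : fps K) (H P Q : {poly {poly K}}).

Lemma ratio_power (a b x y : K) d e :
  a != 0 -> b != 0 -> x != 0 -> y != 0 -> (0 < d)%N -> coprime d e ->
  a ^+ e * y ^+ d = x ^+ e * b ^+ d ->
  exists C, [/\ C != 0, a = x * C ^+ d & b = y * C ^+ e].
Proof.
move=> a0 b0 x0 y0 d0 co ratio.
have [||//|//||C [C0 aC bC]] := @coprime_power_pair _ (a / x) (b / y) d e.
- by rewrite mulf_neq0 ?invr_eq0.
- by rewrite mulf_neq0 ?invr_eq0.
- rewrite !expr_div_n; apply/eqP; rewrite eqr_div ?expf_neq0 //.
  by rewrite ratio mulrC.
by exists C; rewrite -aC -bC mulrCA divff // mulr1 mulrCA divff // mulr1.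
Qed.

Lemma max_eq0_le0 (x y : rat) : Num.max x y = 0 -> x <= 0 /\ y <= 0.
Proof. by move=> <-; rewrite !le_max !lexx orbT. Qed.

Lemma fps_den_pos phi : 0 < (fps_den phi)%:R :> rat.
Proof. by rewrite ltr0n fps_den_gt0. Qed.

Lemma deg_at_le0 H phi : deg_at H phi <= 0 -> fple 0 (subst_fps H phi).
Proof.
rewrite /deg_at pmulr_lle0; last exact: fps_den_pos.
move=> le0 s s0; apply: fple_lead_exp.
exact: le_lt_trans le0 s0.
Qed.

Lemma deg_at_lead H psi (x : rat) : deg_at H psi = x ->
  lead_exp (subst_fps H psi) = x / (fps_den psi)%:R.
Proof.
by move=> <-; rewrite /deg_at mulfK //; apply: lt0r_neq0; apply: fps_den_pos.
Qed.

(** [lead_exp 0] is 0 by convention, so a nonzero exponent certifies F != 0. *)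
Lemma lead_exp_neq0 F : lead_exp F != 0 -> lead_term F != 0.
Proof.
move=> le0; have : F != 0.
  by apply: contraNneq le0 => ->; rewrite /lead_exp msupp0 big_nil.
by case/lead_expP.
Qed.

Lemma shear_pure F g r : fple 0 (shear g F) -> 0 < r -> F@_r`_0 = 0.
Proof.
move=> le0 r0; have := coef_shear g F r 0; rewrite mulr0 addr0 => <-.
by rewrite le0 // coef0.
Qed.

Lemma shear_subst_at psi phi H t :
  shear t (subst_at H (fps_eval psi (xi_at psi phi 0))) =
  subst_at H (fps_eval psi (xi_at psi phi t)).
Proof. by rewrite shear_subst_fps shear_xi_at. Qed.

Lemma size_comp_shift (p : {poly K}) c :
  size (p \Po (c%:P + 'X)) = size p /\
  lead_coef (p \Po (c%:P + 'X)) = lead_coef p.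
Proof.
have sz : size (c%:P + 'X) = 2%N by rewrite addrC size_XaddC.
split; first by rewrite size_comp_poly2.
by rewrite lead_coef_comp ?sz // addrC lead_coefXaddC expr1n mulr1.
Qed.

(** At t = 0, xi becomes c + xi + lower terms: the leading coefficient is only translated by c,
    which keeps its degree and top coefficient. *)
Lemma lead_at_start psi phi H c a :
  fple 0 (shift psi phi) -> (shift psi phi)@_0 = c%:P ->
  lead_exp (subst_fps H psi) = a -> a != 0 ->
  let f := subst_at H (fps_eval psi (xi_at psi phi 0)) in
  [/\ fple a f, f@_a != 0, size f@_a = size (lcoef_at H psi) &
      lead_coef f@_a = lead_coef (lcoef_at H psi)].
Proof.
move=> sh_le sh0 ha a0 f.
have xi_le : fple 0 (xi_at psi phi 0).
  apply: fpleD => // r r0; rewrite coef_fpmono oppr0; case: eqP => // req.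
  by rewrite -req ltxx in r0.
have xi0 : (xi_at psi phi 0)@_0 = c%:P + 'X.
  by rewrite mcoeffD sh0 coef_fpmono oppr0 eqxx.
have [fle fa] := xi_subst_lead xi_le xi0 (@fple_lead_exp _ (subst_fps H psi)).
have lead0 : lead_term (subst_fps H psi) != 0 by rewrite lead_exp_neq0 ?ha.
have fE : f = xi_subst (xi_at psi phi 0) (subst_fps H psi).
  by rewrite /f fps_eval_xi_subst -xi_subst_subst_at.
have [szf leadf] := size_comp_shift (lead_term (subst_fps H psi)) c.
rewrite -/(lead_term _) -fE ha in fle fa; rewrite fa.
by split=> //; rewrite -size_poly_gt0 szf size_poly_gt0.
Qed.

Lemma dominates_start F r0 k0 : fple r0 F ->
  (forall k, (k < k0)%N -> F@_r0`_k = 0) ->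
  dominates F 0 r0 k0 /\
  (forall r k, F@_r`_k != 0 -> (k < k0)%N -> r - 0 * k%:R < r0 - 0 * k0%:R).
Proof.
move=> Fle low; have le r k : F@_r`_k != 0 -> r <= r0.
  by apply: contraNT; rewrite -ltNge => /Fle ->; rewrite coef0.
split=> [r k /le|r k Frk kk]; rewrite !mul0r !subr0 //.
rewrite lt_neqAle (le _ _ Frk) andbT; apply: contraNneq Frk => ->.
by rewrite low.
Qed.

Lemma nonsingular_dicritical P Q psi phi (M d e : nat) :
  (0 < M)%N -> (0 < d)%N -> (0 < e)%N -> coprime d e ->
  deg_at P psi = (M * d)%:R -> deg_at Q psi = (M * e)%:R ->
  dicritical P Q phi -> fps_prec psi phi -> ~ singular P Q psi ->
  (exists N : nat, [/\ (0 < N)%N,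
      (size (lcoef_at P psi)).-1 = (N * d)%N &
      (size (lcoef_at Q psi)).-1 = (N * e)%N]) /\
  (deg_at P phi = 0 /\ deg_at Q phi = 0 /\
   exists (C : K) (D : nat), [/\ C != 0, (0 < D)%N,
      exists2 p : {poly K}, (size p <= D * d)%N &
        lcoef_at P phi
          = (lead_coef (lcoef_at P psi) * C ^+ d) *: 'X^(D * d) + p &
      exists2 q : {poly K}, (size q <= D * e)%N &
        lcoef_at Q phi
          = (lead_coef (lcoef_at Q psi) * C ^+ e) *: 'X^(D * e) + q]).
Proof.
move=> M0 d0 e0 co degP degQ [hor /max_eq0_le0[degP0 degQ0]].
move=> [c [L [Lneg Ephi]]] nonsing.
have [_ sh_le sh0] := prec_shift Lneg Ephi.
pose Y0 := fps_eval psi (xi_at psi phi 0).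
have [F FE] : exists F, F = subst_at P Y0 by eexists.
have [G GE] : exists G, G = subst_at Q Y0 by eexists.
have [g gE] : exists g, g = gap psi phi by eexists.
have shear_phi H : shear g (subst_at H Y0) = subst_fps H phi.
  rewrite shear_subst_at gE (xi_at_gap Ephi) -Ephi.
  exact: esym (subst_fpsE H phi).
have Pphi : subst_fps P phi = shear g F.
  by rewrite FE; exact: esym (shear_phi P).
have Qphi : subst_fps Q phi = shear g G.
  by rewrite GE; exact: esym (shear_phi Q).
have Fphi := deg_at_le0 degP0; have Gphi := deg_at_le0 degQ0.
rewrite Pphi in Fphi; rewrite Qphi in Gphi.
have [alpha alphaE] : exists al : rat, al = M%:R / (fps_den psi)%:R by eexists.
have alpha0 : 0 < alpha.
  by rewrite alphaE; apply: divr_gt0; [rewrite ltr0n | exact: fps_den_pos].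
have lead_psi H n : deg_at H psi = (M * n)%:R ->
    lead_exp (subst_fps H psi) = alpha * n%:R.
  by move=> /deg_at_lead ->; rewrite alphaE natrM mulrAC.
have al_neq0 n : (0 < n)%N -> alpha * n%:R != 0.
  by move=> n0; apply: lt0r_neq0; apply: mulr_gt0; rewrite // ltr0n.
have := lead_at_start sh_le sh0 (lead_psi _ _ degP) (al_neq0 _ d0).
rewrite -/Y0 -FE => -[Fle p0 szp leadp].
have := lead_at_start sh_le sh0 (lead_psi _ _ degQ) (al_neq0 _ e0).
rewrite -/Y0 -GE => -[Gle q0 szq leadq].
have edge t al : 0 <= t -> 0 < al ->
    fple (al * d%:R) (shear t F) -> fple (al * e%:R) (shear t G) ->
    (shear t F)@_(al * d%:R)`_0 = 0 -> (shear t G)@_(al * e%:R)`_0 = 0 ->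
    let p := (shear t F)@_(al * d%:R) in
    let q := (shear t G)@_(al * e%:R) in
    d%:R *: (p * q^`()) = e%:R *: (p^`() * q).
  rewrite FE GE !shear_subst_at => t0 al0.
  exact: nonsingular_edge nonsing t0 al0 sh_le sh0.
have Fpure r := shear_pure (r := r) Fphi.
have Gpure r := shear_pure (r := r) Gphi.
(* The edge at t = 0 yields N for (i), and its lowest vertices, indexed by s, start the walk. *)
have := edge_at d0 e0 co Fpure Gpure edge (lexx 0) alpha0.
have shear0 (H : fp) : shear 0 H = H.
  apply/malgP => r; apply/polyP => k.
  by rewrite coef_shear mul0r addr0.
rewrite (shear0 F) (shear0 G) => /(_ Fle Gle p0 q0).
move=> [N [s [szF szG s0 [Fs Gs Flow Glow] ratio]]].
have [domF lowF] := dominates_start Fle Flow.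
have [domG lowG] := dominates_start Gle Glow.
have s_alpha : 0 * s%:R < alpha by rewrite mul0r.
have [tau [D [tau0 D0 zeF zeG [aF aG ratioD]]]] :=
  newton_walk d0 e0 co Fpure Gpure edge s0 (lexx 0) s_alpha
    domF domG lowF lowG Fs Gs ratio.
have Dd0 : (0 < D * d)%N by rewrite muln_gt0 D0.
have De0 : (0 < D * e)%N by rewrite muln_gt0 D0.
(* F has no positive exponent at slope g, so tau <= g; horizontality of phi for P or for Q gives g
   <= tau. *)
have g_tau : g = tau.
  apply/eqP; rewrite eq_le (zero_edge_slope_le zeF Dd0 aF Fphi) andbT.
  case: hor => -[/deg_at_lead]; rewrite mul0r /lcoef_at /lead_term => ->.
    by rewrite Pphi; apply: zero_edge_slope_ge zeF.
  by rewrite Qphi; apply: zero_edge_slope_ge zeG.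
rewrite g_tau in Pphi Qphi.
have [_ leadF [p szp' pE]] := zero_edge_lead zeF aF.
have [_ leadG [q szq' qE]] := zero_edge_lead zeG aG.
have lA : lead_coef (lcoef_at P psi) != 0.
  by rewrite -leadp lead_coef_eq0.
have lB : lead_coef (lcoef_at Q psi) != 0.
  by rewrite -leadq lead_coef_eq0.
rewrite leadp leadq in ratioD.
move: pE qE aF aG ratioD; move: F@__`__ G@__`__ => a b pE qE a0 b0 ratioD.
have [C [C0 aC bC]] := ratio_power a0 b0 lA lB d0 co ratioD.
split.
  exists N; rewrite -szp -szq szF szG; split; [|exact: erefl|exact: erefl].
  rewrite lt0n; apply: contraNneq Fs => N0.
  by rewrite nth_default // szF N0 mul0n muln_gt0 s0.
split; first by rewrite /deg_at Pphi leadF mul0r.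
split; first by rewrite /deg_at Qphi leadG mul0r.
exists C, D; split; [exact: C0 | exact: D0 | |].
  by exists p; [exact: szp' | rewrite -aC -pE -Pphi].
by exists q; [exact: szq' | rewrite -bC -qE -Qphi].
Qed.

End Conclusion.

Theorem theorem1p1 (R : realType) (P Q : {poly {poly R[i]}})
  (P_nonconst : ~ exists c : R[i], P = c%:P%:P)
  (Q_nonconst : ~ exists c : R[i], Q = c%:P%:P)
  (degyP : degy P = total_deg P) (degyQ : degy Q = total_deg Q)
  (jac_neq0 : jacobian P Q != 0)
  (psi : fps R[i])
  (a_psi_gt0 : 0 < deg_at P psi) (b_psi_gt0 : 0 < deg_at Q psi)
  (M d e : nat) (M_gt0 : (0 < M)%N) (d_gt0 : (0 < d)%N) (e_gt0 : (0 < e)%N)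
  (a_psi : deg_at P psi = (M * d)%:R) (b_psi : deg_at Q psi = (M * e)%:R)
  (co_de : gcdn d e = 1%N)
  (phi : fps R[i]) (dicr : dicritical P Q phi) (prec : fps_prec psi phi)
  (nonsing : ~ singular P Q psi) :
  (exists N : nat, [/\ (0 < N)%N,
      (size (lcoef_at P psi)).-1 = (N * d)%N &
      (size (lcoef_at Q psi)).-1 = (N * e)%N]) /\
  (deg_at P phi = 0 /\ deg_at Q phi = 0 /\
   exists (C : R[i]) (D : nat), [/\ C != 0, (0 < D)%N,
      exists2 p : {poly R[i]}, (size p <= D * d)%N &
        lcoef_at P phi
          = (lead_coef (lcoef_at P psi) * C ^+ d) *: 'X^(D * d) + p &
      exists2 q : {poly R[i]}, (size q <= D * e)%N &
        lcoef_at Q phi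
          = (lead_coef (lcoef_at Q psi) * C ^+ e) *: 'X^(D * e) + q]).
Proof.
have co : coprime d e by apply/eqP.
exact: nonsingular_dicritical M_gt0 d_gt0 e_gt0 co a_psi b_psi dicr prec
  nonsing.
Qed.
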